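(* Let $A$ be an $m\times m$ matrix-valued function with entries in $\mathcal N^\infty$ such that $\det A\neq0$, and let $\Phi=[\varphi_1,\cdots,\varphi_r]\in L^2_{M_{m\times r}}$. Let $\psi_i$ denote the $i$-th column of $\Psi:=A\Phi$. Then $\mathrm{ind}_{\mathcal N}\{\varphi_1,\cdots,\varphi_r\}=\mathrm{ind}_{\mathcal N}\{\psi_1,\cdots,\psi_r\}$.
   Context: $\mathbb T$ is the unit circle. The Nevanlinna class $\mathcal N$ is the set of functions on $\mathbb T$ of the form $f/g$ with $f,g\in H^\infty$, $g\neq0$; $\mathcal N^p=\mathcal N\cap L^p$, and $\mathcal N_{\mathbb C^n}$ denotes column vectors with entries in $\mathcal N$. $\det A\neq 0$ means $\det A$ is not the zero function. Vectors $\varphi_1,\dots,\varphi_r\in L^2_{\mathbb C^n}$ are independent modulo Nevanlinna class if $a_1,\dots,a_r\in\mathcal N$ and $\sum a_i\varphi_i\in\mathcal N_{\mathbb C^n}$ imply $a_1=\cdots=a_r=0$. For a finite list $B$ of vectors in $L^2_{\mathbb C^n}$, $\mathrm{ind}_{\mathcal N}B$ is the largest cardinality of a sub-list that is independent modulo Nevanlinna class ($0$ if none). *)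

(* Defs.v *)
From HB Require Import structures.
From mathcomp Require Import all_boot all_order all_algebra.
From mathcomp Require Import all_classical all_reals all_analysis.
From mathcomp.real_closed Require Import complex.

Set Implicit Arguments.
Unset Strict Implicit.
Unset Printing Implicit Defensive.

Import Order.TTheory GRing.Theory Num.Theory.
Import numFieldNormedType.Exports.
Local Open Scope classical_set_scope.
Local Open Scope ring_scope.

Section Nevanlinna.
Variable R : realType.

(* The unit circle T is parametrized by t in [0, 2 pi] (t |-> e^{it});
   functions on T are functions R -> R[i], only their values on this
   interval matter; the measure is Lebesgue measure. *)
Definition circD : set R := `[0, 2 * pi]%classic.

Definition lebR := (@lebesgue_measure R).

Definition ae_T (P : R -> Prop) : Prop :=
  lebR.-negligible (circD `&` ~` [set x | P x]).

Definition cmeas (f : R -> R[i]) : Prop :=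
  measurable_fun circD (fun x => complex.Re (f x)) /\
  measurable_fun circD (fun x => complex.Im (f x)).

Definition cnorm2 (z : R[i]) : R := complex.Re z ^+ 2 + complex.Im z ^+ 2.

Definition inL2 (f : R -> R[i]) : Prop :=
  cmeas f /\ (\int[lebR]_(x in circD) (cnorm2 (f x))%:E < +oo)%E.

Definition inLinf (f : R -> R[i]) : Prop :=
  cmeas f /\ exists M : R, ae_T (fun x => cnorm2 (f x) <= M).

(* H^oo(T) = { f in L^oo : hat f(-n) = 0 for all n >= 1 }, where
   hat f(-n) = (1/2pi) int_0^{2pi} f(t) e^{int} dt; real and imaginary
   parts of f(t) e^{int} are written out. *)
Definition inHinf (f : R -> R[i]) : Prop :=
  inLinf f /\
  forall n : nat, (0 < n)%N ->
    (\int[lebR]_(x in circD)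
        (complex.Re (f x) * cos (n%:R * x) - complex.Im (f x) * sin (n%:R * x))%:E
       = 0)%E /\
    (\int[lebR]_(x in circD)
        (complex.Re (f x) * sin (n%:R * x) + complex.Im (f x) * cos (n%:R * x))%:E
       = 0)%E.

Definition inN (f : R -> R[i]) : Prop :=
  exists g h : R -> R[i], [/\ inHinf g, inHinf h,
    ~ ae_T (fun x => h x = 0) & ae_T (fun x => f x = g x / h x)].

Definition inNinf (f : R -> R[i]) : Prop := inN f /\ inLinf f.

Definition inNvec (n : nat) (v : R -> 'cV[R[i]]_n) : Prop :=
  forall i : 'I_n, inN (fun x => v x i 0).

Definition indep_modN (n r : nat) (phi : 'I_r -> R -> 'cV[R[i]]_n)
    (S : {set 'I_r}) : Prop :=
  forall a : 'I_r -> R -> R[i],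
    (forall i, i \in S -> inN (a i)) ->
    inNvec (fun x => \sum_(i in S) a i x *: phi i x) ->
    forall i, i \in S -> ae_T (fun x => a i x = 0).

(* ind_N of the list phi_0, ..., phi_{r-1}: the largest cardinality of an
   independent sub-list (0 if none, the empty sub-list being independent) *)
Definition indN (n r : nat) (phi : 'I_r -> R -> 'cV[R[i]]_n) : nat :=
  (\max_(S : {set 'I_r} | `[< indep_modN phi S >]) #|S|)%N.

End Nevanlinna.

(* Main.v *)
Require Import Defs.
From HB Require Import structures.
From mathcomp Require Import all_boot all_order all_algebra.
From mathcomp Require Import all_classical all_reals all_analysis.
From mathcomp.real_closed Require Import complex.
From mathcomp Require Import measurable_realfun ring lra.

Import Order.TTheory GRing.Theory Num.Theory.
Import numFieldNormedType.Exports.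
Local Open Scope classical_set_scope.
Local Open Scope ring_scope.

Set Implicit Arguments.
Unset Strict Implicit.
Unset Printing Implicit Defensive.

(** The class [N] is a field up to null sets, hence stable under determinants
    and adjugates. A relation [sum a_i psi_i] in [N^m], multiplied by [adj A],
    becomes [sum (det A a_i) phi_i] in [N^m], and [det A a_i = 0] forces
    [a_i = 0]; the converse implication multiplies by [A]. So the independent
    sub-lists of the [phi_i] and of the [psi_i] are the same.

    Stability of [N] under sums and products rests on two facts about [H^oo].
    It is an algebra: an element of [H^oo] is an L^2 limit of analytic
    polynomials, because trigonometric polynomials are L^2-dense and dropping
    their negative frequencies only improves the approximation. A nonzero
    element vanishes only on a null set: after removing the zero at the origin,
    test it against the analytic polynomials [(1 + L q / n)^n], where [Re q] is
    close to the indicator of the zero set. *)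

Local Notation Re := (@complex.Re _).
Local Notation Im := (@complex.Im _).

(** * Integration of bounded measurable real functions over the circle *)

Section BoundedMeasurable.
Variable R : realType.
Implicit Types (u v : R -> R) (c : R).

Local Notation D := (@circD R).

(** The bound holds at every point of [D], so the class is closed under products and powers without
    exceptional sets, and each member is integrable because [D] has finite measure. *)
Definition bmeas u : Prop :=
  measurable_fun D u /\ exists M : R, forall x, D x -> `|u x| <= M.

Definition RI u : R := \int[@lebR R]_(x in D) u x.

Lemma measurable_circD : measurable D.
Proof. exact: measurable_itv. Qed.
Local Hint Resolve measurable_circD : core.

Lemma pi2_gt0 : 0 < 2 * pi :> R.
Proof. by rewrite mulr_gt0// pi_gt0. Qed.

Lemma lebR_circD : lebR D = (2 * pi)%:E.
Proof.
rewrite /lebR /circD lebesgue_measure_itv /= lte_fin pi2_gt0.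
by rewrite -EFinB subr0.
Qed.

Lemma bmeas_integrable u : bmeas u -> (@lebR R).-integrable D (EFin \o u).
Proof.
move=> [mu [M uM]]; apply: measurable_bounded_integrable => //.
  by apply: (@le_lt_trans _ _ (2 * pi)%:E); rewrite ?ltry// -lebR_circD.
exists M; split; first exact: num_real.
by move=> y My x Dx; apply: (le_trans (uM _ Dx)); exact: ltW.
Qed.

Lemma bmeas_cst c : bmeas (fun=> c).
Proof. by split; [exact: measurable_cst|exists `|c|]. Qed.

Lemma bmeasD u v : bmeas u -> bmeas v -> bmeas (fun x => u x + v x).
Proof.
move=> [mu [M uM]] [mv [N vN]]; split; first exact: measurable_funD.
exists (M + N) => x Dx; apply: (le_trans (ler_normD _ _)).
by apply: lerD; [exact: uM|exact: vN].
Qed.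

Lemma bmeasM u v : bmeas u -> bmeas v -> bmeas (fun x => u x * v x).
Proof.
move=> [mu [M uM]] [mv [N vN]]; split; first exact: measurable_funM.
exists (M * N) => x Dx; rewrite normrM.
by apply: ler_pM => //; [exact: uM|exact: vN].
Qed.

Lemma bmeasZ c u : bmeas u -> bmeas (fun x => c * u x).
Proof. by move=> bu; apply: bmeasM => //; exact: bmeas_cst. Qed.

Lemma bmeasN u : bmeas u -> bmeas (fun x => - u x).
Proof.
move=> bu; rewrite (_ : (fun x => - u x) = (fun x => (-1) * u x)).
  exact: bmeasZ.
by apply/funext => x; rewrite mulN1r.
Qed.

Lemma bmeasB u v : bmeas u -> bmeas v -> bmeas (fun x => u x - v x).
Proof. by move=> bu bv; apply: bmeasD => //; exact: bmeasN. Qed.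

Lemma bmeasX n u : bmeas u -> bmeas (fun x => u x ^+ n).
Proof.
move=> bu; elim: n => [|n IH].
  by under eq_fun do rewrite expr0; exact: bmeas_cst.
by under eq_fun do rewrite exprS; exact: bmeasM.
Qed.

Lemma bmeas_norm u : bmeas u -> bmeas (fun x => `|u x|).
Proof.
move=> [mu [M uM]]; split; first exact: measurableT_comp.
by exists M => x Dx; rewrite normr_id; exact: uM.
Qed.

Lemma bmeas_indic (E : set R) : measurable E -> bmeas (\1_E).
Proof.
move=> mE; split; first exact: measurable_indic.
by exists 1 => x _; rewrite indicE; case: (_ \in _); rewrite ?normr1 ?normr0.
Qed.

Lemma bmeas_cos : bmeas (@cos R).
Proof.
split; last by exists 1 => x _; exact: cos_max.
by apply: measurable_funTS; apply: continuous_measurable_fun => x; exact: continuous_cos.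
Qed.

Lemma bmeas_sin : bmeas (@sin R).
Proof.
split; last by exists 1 => x _; exact: sin_max.
by apply: measurable_funTS; apply: continuous_measurable_fun => x; exact: continuous_sin.
Qed.

Lemma bmeas_sum (I : Type) (s : seq I) (F : I -> R -> R) :
  (forall i, bmeas (F i)) -> bmeas (fun x => \sum_(i <- s) F i x).
Proof.
move=> bF; elim: s => [|i s IH].
  by under eq_fun do rewrite big_nil; exact: bmeas_cst.
by under eq_fun do rewrite big_cons; exact: bmeasD.
Qed.

Lemma eq_RI u v : (forall x, D x -> u x = v x) -> RI u = RI v.
Proof. by move=> uv; apply: eq_Rintegral => x /set_mem /uv. Qed.

Lemma RID u v : bmeas u -> bmeas v -> RI (fun x => u x + v x) = RI u + RI v.
Proof. by move=> bu bv; apply: RintegralD => //; exact: bmeas_integrable. Qed.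

Lemma RIZ c u : bmeas u -> RI (fun x => c * u x) = c * RI u.
Proof. by move=> bu; apply: RintegralZl => //; exact: bmeas_integrable. Qed.

Lemma RIN u : bmeas u -> RI (fun x => - u x) = - RI u.
Proof.
move=> bu; rewrite -mulN1r -RIZ//.
by congr RI; apply/funext => x; rewrite mulN1r.
Qed.

Lemma RIB u v : bmeas u -> bmeas v -> RI (fun x => u x - v x) = RI u - RI v.
Proof. by move=> bu bv; rewrite RID ?RIN//; exact: bmeasN. Qed.

Lemma RI_cst c : RI (fun=> c) = c * (2 * pi).
Proof.
have /= := @Rintegral_cst _ _ _ (@lebR R) D measurable_circD c.
rewrite /RI => ->; congr (_ * _).
exact: (congr1 fine lebR_circD).
Qed.

Lemma RI_ge0 u : (forall x, D x -> 0 <= u x) -> 0 <= RI u.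
Proof. by move=> u0; apply: Rintegral_ge0. Qed.

Lemma le_RI u v : bmeas u -> bmeas v -> (forall x, D x -> u x <= v x) ->
  RI u <= RI v.
Proof. by move=> bu bv uv; apply: le_Rintegral => //; exact: bmeas_integrable. Qed.

Lemma norm_RI u : bmeas u -> `|RI u| <= RI (fun x => `|u x|).
Proof. by move=> bu; apply: le_normr_Rintegral => //; exact: bmeas_integrable. Qed.

Lemma integral_RI u : bmeas u ->
  (\int[@lebR R]_(x in D) (u x)%:E = (RI u)%:E)%E.
Proof.
move=> bu; rewrite /RI /Rintegral fineK//.
by apply: integrable_fin_num => //; exact: bmeas_integrable.
Qed.

Lemma ae_T_imp (P Q : R -> Prop) :
  (forall x, D x -> P x -> Q x) -> ae_T P -> ae_T Q.
Proof.
by move=> PQ; apply: negligibleS => x [Dx nQ]; split => // Px; exact/nQ/PQ.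
Qed.

Lemma ae_T_and (P Q : R -> Prop) :
  ae_T P -> ae_T Q -> ae_T (fun x => P x /\ Q x).
Proof.
move=> aP aQ; apply: negligibleS (negligibleU aP aQ) => x [Dx /= nPQ].
by have [Px|nPx] := pselect (P x); [right|left]; split => // Qx; exact: nPQ.
Qed.

Lemma ae_T_all (P : R -> Prop) : (forall x, D x -> P x) -> ae_T P.
Proof.
move=> aP; exists set0; split => // x [Dx /= nP].
exact/nP/aP.
Qed.

Lemma RI_eq0_ae u : bmeas u -> (forall x, D x -> 0 <= u x) -> RI u = 0 ->
  ae_T (fun x => u x = 0).
Proof.
move=> bu u0 Iu.
have : (\int[@lebR R]_(x in D) `|(u x)%:E| = 0)%E.
  rewrite -[RHS]/(0%:E) -Iu -integral_RI//; apply: eq_integral => x /set_mem Dx.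
  by rewrite /= ger0_norm// u0.
have mu : measurable_fun D (EFin \o u) by apply/measurable_EFinP; case: bu.
move/(ae_eq_integral_abs (@lebR R) measurable_circD mu).1.
apply: negligibleS => x [Dx /= nu] /(_ Dx) []; exact: nu.
Qed.

End BoundedMeasurable.

(** * Real and imaginary parts, conjugation and the squared modulus *)

Section ComplexParts.
Variable R : realType.
Implicit Types (z w : R[i]) (r : R).

Lemma RecD z w : Re (z + w) = Re z + Re w. Proof. by case: z; case: w. Qed.
Lemma ImcD z w : Im (z + w) = Im z + Im w. Proof. by case: z; case: w. Qed.
Lemma RecN z : Re (- z) = - Re z. Proof. by case: z. Qed.
Lemma ImcN z : Im (- z) = - Im z. Proof. by case: z. Qed.
Lemma RecM z w : Re (z * w) = Re z * Re w - Im z * Im w.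
Proof. by case: z; case: w. Qed.
Lemma ImcM z w : Im (z * w) = Re z * Im w + Im z * Re w.
Proof. by case: z => a b; case: w => c d. Qed.
Lemma RecJ z : Re (conjc z) = Re z. Proof. by case: z. Qed.
Lemma ImcJ z : Im (conjc z) = - Im z. Proof. by case: z. Qed.
Lemma conjcD z w : conjc (z + w) = conjc z + conjc w. Proof. exact: rmorphD. Qed.
Lemma conjcM z w : conjc (z * w) = conjc z * conjc w. Proof. exact: rmorphM. Qed.
Lemma complex_ext z w : Re z = Re w -> Im z = Im w -> z = w.
Proof. by case: z => a b; case: w => c d /= -> ->. Qed.

Definition complexPartsE := (RecD, ImcD, RecN, ImcN, RecM, ImcM, RecJ, ImcJ).

Lemma cnorm2_ge0 z : 0 <= cnorm2 z.
Proof. by rewrite /cnorm2 addr_ge0// sqr_ge0. Qed.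

Lemma cnorm2_eq0 z : (cnorm2 z == 0) = (z == 0).
Proof. by rewrite /cnorm2 paddr_eq0 ?sqr_ge0// !sqrf_eq0 eq_complex. Qed.

Lemma cnorm2M z w : cnorm2 (z * w) = cnorm2 z * cnorm2 w.
Proof. by rewrite /cnorm2 !complexPartsE; ring. Qed.

Lemma cnorm2X z n : cnorm2 (z ^+ n) = cnorm2 z ^+ n.
Proof.
elim: n => [|n IH]; last by rewrite !exprS cnorm2M IH.
by rewrite !expr0 /cnorm2 /= expr0n /= addr0 expr1n.
Qed.

Lemma mulJc z : conjc z * z = (cnorm2 z)%:C%C.
Proof. by apply: complex_ext; rewrite !complexPartsE /cnorm2 /=; ring. Qed.

End ComplexParts.

(** * Complex integrals over the circle and the exponentials e^{inx} *)

Section ComplexIntegral.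
Variable R : realType.
Implicit Types (f g : R -> R[i]) (c z : R[i]).

Local Notation D := (@circD R).

Definition cb f : Prop := bmeas (fun x => Re (f x)) /\ bmeas (fun x => Im (f x)).

(** The integral is not normalised: the zeroth Fourier coefficient of [f] is [cI f] divided by 2
    pi. *)
Definition cI f : R[i] := Complex (RI (fun x => Re (f x))) (RI (fun x => Im (f x))).

Lemma cb_cst c : cb (fun=> c).
Proof. by split; exact: bmeas_cst. Qed.

Lemma cbD f g : cb f -> cb g -> cb (fun x => f x + g x).
Proof.
move=> [f1 f2] [g1 g2]; split.
  by under eq_fun do rewrite RecD; exact: bmeasD.
by under eq_fun do rewrite ImcD; exact: bmeasD.
Qed.

Lemma cbM f g : cb f -> cb g -> cb (fun x => f x * g x).
Proof.
move=> [f1 f2] [g1 g2]; split.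
  by under eq_fun do rewrite RecM; apply: bmeasB; exact: bmeasM.
by under eq_fun do rewrite ImcM; apply: bmeasD; exact: bmeasM.
Qed.

Lemma cbZ c f : cb f -> cb (fun x => c * f x).
Proof. by move=> bf; apply: cbM => //; exact: cb_cst. Qed.

Lemma cbN f : cb f -> cb (fun x => - f x).
Proof. by move=> bf; under eq_fun do rewrite -mulN1r; exact: cbZ. Qed.

Lemma cbB f g : cb f -> cb g -> cb (fun x => f x - g x).
Proof. by move=> bf bg; apply: cbD => //; exact: cbN. Qed.

Lemma cbX n f : cb f -> cb (fun x => f x ^+ n).
Proof.
move=> bf; elim: n => [|n IH].
  by under eq_fun do rewrite expr0; exact: cb_cst.
by under eq_fun do rewrite exprS; exact: cbM.
Qed.

Lemma cbJ f : cb f -> cb (fun x => conjc (f x)).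
Proof.
move=> [f1 f2]; split; first by under eq_fun do rewrite RecJ.
by under eq_fun do rewrite ImcJ; exact: bmeasN.
Qed.

Lemma cb_horner (p : {poly R[i]}) f : cb f -> cb (fun x => p.[f x]).
Proof.
move=> bf; elim/poly_ind: p => [|p c IH].
  by under eq_fun do rewrite horner0; exact: cb_cst.
under eq_fun do rewrite hornerMXaddC.
by apply: cbD; [exact: cbM|exact: cb_cst].
Qed.

Lemma bmeas_cnorm2 f : cb f -> bmeas (fun x => cnorm2 (f x)).
Proof. by move=> [f1 f2]; apply: bmeasD; exact: bmeasX. Qed.

Lemma cID f g : cb f -> cb g -> cI (fun x => f x + g x) = cI f + cI g.
Proof.
move=> [f1 f2] [g1 g2]; apply: complex_ext; rewrite complexPartsE /cI /=.
  by under [in LHS]eq_fun do rewrite RecD; rewrite RID.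
by under [in LHS]eq_fun do rewrite ImcD; rewrite RID.
Qed.

Lemma cIZ c f : cb f -> cI (fun x => c * f x) = c * cI f.
Proof.
move=> [f1 f2]; apply: complex_ext; rewrite complexPartsE /cI /=.
  by under [in LHS]eq_fun do rewrite RecM; rewrite RIB ?RIZ//; exact: bmeasZ.
by under [in LHS]eq_fun do rewrite ImcM; rewrite RID ?RIZ//; exact: bmeasZ.
Qed.

Lemma cIN f : cb f -> cI (fun x => - f x) = - cI f.
Proof.
by move=> bf; under [in LHS]eq_fun do rewrite -mulN1r; rewrite cIZ// mulN1r.
Qed.

Lemma cIB f g : cb f -> cb g -> cI (fun x => f x - g x) = cI f - cI g.
Proof. by move=> bf bg; rewrite cID ?cIN//; exact: cbN. Qed.

Lemma cI_cst c : cI (fun=> c) = c * (2 * pi)%:C%C.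
Proof.
by apply: complex_ext; rewrite complexPartsE /= RI_cst ?mulr0 ?subr0 ?add0r.
Qed.

(** The boundary point e^{ix}; analytic polynomials appear throughout as [p.[circ x]], negative
    frequencies as powers of [conjc (circ x)]. *)
Definition circ (x : R) : R[i] := Complex (cos x) (sin x).

Lemma circX n (x : R) : circ x ^+ n = circ (n%:R * x).
Proof.
elim: n => [|n IH]; first by rewrite expr0 mul0r /circ cos0 sin0.
rewrite exprS IH -natr1 mulrDl mul1r addrC /circ cosD sinD.
by apply: complex_ext; rewrite complexPartsE /=; ring.
Qed.

Lemma cb_circ : cb circ.
Proof. by split; [exact: bmeas_cos|exact: bmeas_sin]. Qed.

Lemma cnorm2_circ (x : R) : cnorm2 (circ x) = 1.
Proof. by rewrite /cnorm2 /= cos2Dsin2. Qed.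

Lemma mulJ_circ (x : R) : conjc (circ x) * circ x = 1.
Proof. by rewrite mulJc cnorm2_circ. Qed.

Lemma cb_circX n : cb (fun x => circ x ^+ n).
Proof. exact/cbX/cb_circ. Qed.

Lemma cb_hcirc (p : {poly R[i]}) : cb (fun x => p.[circ x]).
Proof. exact/cb_horner/cb_circ. Qed.

Lemma RI_FTC (F f : R -> R) : continuous f ->
  (forall x : R, is_derive x 1 F (f x)) -> RI f = F (2 * pi) - F 0.
Proof.
move=> cf dF.
have cF : continuous F.
  move=> x; apply: differentiable_continuous; apply/derivable1_diffP.
  by have [] := dF x.
rewrite /RI /Rintegral /lebR /circD.
rewrite (@continuous_FTC2 _ f F) ?pi2_gt0//.
- exact: continuous_subspaceT.
- split; first by move=> x _; have [] := dF x.
  + by apply: cvg_at_right_filter; exact: cF.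
  + by apply: cvg_at_left_filter; exact: cF.
- by move=> x _; rewrite derive1E; have [] := dF x.
Qed.

Lemma circ2pi : circ (2 * pi) = 1.
Proof. by rewrite /circ mulr_natl cos2pi sin2pi. Qed.

Lemma cI_circX n : (0 < n)%N -> cI (fun x => circ x ^+ n) = 0.
Proof.
move=> n0; have nR : n%:R != 0 :> R by rewrite pnatr_eq0 -lt0n.
have E : circ (n%:R * (2 * pi)) = 1 by rewrite -circX circ2pi expr1n.
have [Ec Es] : cos (n%:R * (2 * pi)) = 1 :> R /\ sin (n%:R * (2 * pi)) = 0 :> R.
  by have := congr1 (@complex.Re _) E; have := congr1 (@complex.Im _) E.
have cn (h : R -> R) : continuous h -> continuous (fun x : R => h (n%:R * x)).
  move=> ch x; apply: continuous_comp; last exact: ch.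
  exact: mulrl_continuous.
(* The primitives sin(nx)/n and -cos(nx)/n take equal values at 0 and 2 pi, by [Es] and [Ec]. *)
apply: complex_ext => /=; under [in LHS]eq_fun do rewrite circX /=.
  have dF (x : R) : is_derive x 1 (fun x => n%:R^-1 * sin (n%:R * x)) (cos (n%:R * x)).
    by apply: is_derive_eq; rewrite /GRing.scale /=; field.
  rewrite (RI_FTC (cn _ (@continuous_cos R)) dF).
  by rewrite Es !mulr0 sin0 mulr0 subrr.
have dF (x : R) : is_derive x 1 (fun x => - n%:R^-1 * cos (n%:R * x)) (sin (n%:R * x)).
  by apply: is_derive_eq; rewrite /GRing.scale /=; field.
rewrite (RI_FTC (cn _ (@continuous_sin R)) dF).
by rewrite Ec mulr0 cos0 subrr.
Qed.

End ComplexIntegral.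

(** * Approximation of indicators of rays by trigonometric polynomials *)

Section TrigonometricApproximation.
Variable R : realType.
Implicit Types (u v Q : R -> R) (p q : {poly R[i]}) (E : set R).

Local Notation D := (@circD R).
Local Notation circ := (@circ R).

(* Taking the real part of analytic polynomials makes the negative frequencies
   implicit. *)
Definition trigpoly Q : Prop := exists p, forall x, Q x = Re p.[circ x].

Lemma trigpoly_bmeas Q : trigpoly Q -> bmeas Q.
Proof.
move=> [p pE]; have [+ _] := cb_hcirc p.
by congr bmeas; apply/funext => x; rewrite pE.
Qed.

Lemma trigpoly_cst (c : R) : trigpoly (fun=> c).
Proof. by exists (c%:C%C)%:P => x; rewrite hornerC. Qed.

Lemma trigpolyD Q1 Q2 : trigpoly Q1 -> trigpoly Q2 ->
  trigpoly (fun x => Q1 x + Q2 x).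
Proof. by move=> [p pE] [q qE]; exists (p + q) => x; rewrite hornerD RecD pE qE. Qed.

Lemma trigpolyZ (c : R) Q : trigpoly Q -> trigpoly (fun x => c * Q x).
Proof.
move=> [p pE]; exists (c%:C%C *: p) => x.
by rewrite hornerZ RecM pE /= mul0r subr0.
Qed.

(** Since [circ x] times its conjugate is 1, the product of the two nonconstant parts loses one
    degree on each side and falls under the induction hypothesis. The remaining terms have a
    constant on one side, and Re z = Re (conj z) makes them analytic. *)
Lemma trigpoly_mulJ p q :
  exists r : {poly R[i]}, forall x, Re (p.[circ x] * conjc q.[circ x]) = Re r.[circ x].
Proof.
elim/poly_ind: q p => [|q c IH] p.
  by exists 0 => x; rewrite !horner0 conjc0 mulr0.
elim/poly_ind: p => [|p a _].
  by exists 0 => x; rewrite !horner0 mul0r.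
have [r rE] := IH p.
exists (conjc c *: (p * 'X + a%:P) + r + conjc a *: (q * 'X)) => x.
have -> : (p * 'X + a%:P).[circ x] * conjc (q * 'X + c%:P).[circ x] =
  conjc c * (p * 'X + a%:P).[circ x] + p.[circ x] * conjc q.[circ x] +
  a * conjc (q.[circ x] * circ x).
  rewrite !hornerMXaddC conjcD !conjcM.
  have := mulJ_circ x.
  move: (circ x) (conjc (circ x)) (conjc c) (conjc q.[_]) => e e' c' q' e1.
  by rewrite -[p.[e] * q']mulr1 -e1; ring.
rewrite [in RHS]hornerD [in RHS]hornerD !hornerZ [in RHS]RecD [in RHS]RecD.
rewrite RecD RecD rE; congr (_ + _).
by rewrite hornerMX !complexPartsE; ring.
Qed.

(** Re u Re v is half of Re (u v) + Re (u conj v); the second term is handled by [trigpoly_mulJ]. *)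
Lemma trigpolyM Q1 Q2 : trigpoly Q1 -> trigpoly Q2 ->
  trigpoly (fun x => Q1 x * Q2 x).
Proof.
move=> [p pE] [q qE]; have [r rE] := trigpoly_mulJ p q.
exists ((2^-1)%:C%C *: (p * q + r)) => x.
rewrite hornerZ RecM /= mul0r subr0 hornerD RecD -rE hornerM pE qE.
by rewrite !complexPartsE; field.
Qed.

Lemma trigpolyX n Q : trigpoly Q -> trigpoly (fun x => Q x ^+ n).
Proof.
move=> tQ; elim: n => [|n IH].
  by under eq_fun do rewrite expr0; exact: trigpoly_cst.
by under eq_fun do rewrite exprS; exact: trigpolyM.
Qed.

Lemma trigpoly_onem Q : trigpoly Q -> trigpoly (fun x => 1 - Q x).
Proof.
move=> tQ; apply: trigpolyD; first exact: trigpoly_cst.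
by under eq_fun do rewrite -mulN1r; exact: trigpolyZ.
Qed.

Lemma trigpoly_cos : trigpoly cos.
Proof. by exists 'X => x; rewrite hornerX. Qed.

Lemma trigpoly_sin : trigpoly sin.
Proof.
exists ((- 'i)%C *: 'X) => x.
by rewrite hornerZ hornerX RecM /=; ring.
Qed.

Lemma RI_dominated0 (u_ : nat -> R -> R) :
  (forall n, bmeas (u_ n)) -> (forall n x, D x -> `|u_ n x| <= 1) ->
  ae_T (fun x => u_ ^~ x @ \oo --> (0 : R)) ->
  forall eps : R, 0 < eps -> exists n, RI (fun x => `|u_ n x|) <= eps.
Proof.
move=> bu u1 ucv eps eps0.
have H := @dominated_convergence _ _ R (@lebR R) D (@measurable_circD R)
  (fun n x => (u_ n x)%:E) (fun=> 0%E) (fun=> 1%E).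
have [| | | | |_ + _] := H.
- by move=> n; apply/measurable_EFinP; case: (bu n).
- exact: measurable_cst.
- apply: negligibleS ucv => x /= nx; apply: contrapT => /= h; apply: nx => Dx.
  suff : u_ ^~ x @ \oo --> (0 : R) by move=> ux; apply: cvg_EFin => //; exact: nearW.
  by apply: contrapT => nux; apply: h.
- exact: (bmeas_integrable (bmeas_cst 1)).
- by apply: aeW => x n Dx; rewrite /= lee_fin u1.
have -> : [sequence (\int[@lebR R]_(x in D) `|(u_ n x)%:E - 0%E|)%E]_n =
  (fun n => (RI (fun x => `|u_ n x|))%:E).
  apply/funext => n /=; rewrite -integral_RI; last exact/bmeas_norm.
  by apply: eq_integral => x _; rewrite subr0.
move=> /fine_cvgP[_] /cvgrPdist_le /(_ _ eps0) [N _ /(_ N (leqnn N))] /=.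
rewrite sub0r normrN => h; exists N; exact: le_trans (ler_norm _) h.
Qed.

(** Closeness is in L^1, but the values of [Q] stay in [0, 1]: this makes products of approximants
    approximate intersections, and later bounds the L^2 error by the L^1 error. *)
Definition trig_approx E : Prop := forall eps : R, 0 < eps -> exists Q,
  [/\ trigpoly Q, forall x, 0 <= Q x <= 1 & RI (fun x => `|\1_E x - Q x|) <= eps].

Lemma bernoulli_onem (z : R) N : 0 <= z <= 1 -> 1 - N%:R * z <= (1 - z) ^+ N.
Proof.
move=> /andP[z0 z1]; elim: N => [|N IH]; first by rewrite mul0r subr0 expr0.
rewrite exprS; apply: (@le_trans _ _ ((1 - z) * (1 - N%:R * z))); last first.
  by rewrite ler_wpM2l// subr_ge0.
rewrite -natr1; have : 0 <= N%:R * z * z by rewrite !mulr_ge0.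
by move=> h; nra.
Qed.

(** The upper companion of Bernoulli's inequality; the induction step is (1 - z)(1 + (N+1) z) <= 1 +
    N z. *)
Lemma onemX_mul_le1 (z : R) N : 0 <= z <= 1 -> (1 - z) ^+ N * (1 + N%:R * z) <= 1.
Proof.
move=> /andP[z0 z1]; elim: N => [|N IH]; first by rewrite mul0r addr0 expr0 mulr1.
apply: le_trans IH; rewrite exprSr -mulrA ler_wpM2l ?exprn_ge0 ?subr_ge0//.
rewrite -natr1; have : 0 <= N%:R * z * z by rewrite !mulr_ge0.
by move=> h; nra.
Qed.

(* Brosowski-Deutsch: (1 - q^n)^(2^n) tends to 1 where q < 1/2 and to 0 where
   q > 1/2. *)
Lemma step_cvg1 (q : R) : 0 <= q < 2^-1 ->
  (fun n => (1 - q ^+ n) ^+ (2 ^ n)) @ \oo --> (1 : R).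
Proof.
move=> /andP[q0 q2].
have q1 : 0 <= q <= 1 by apply/andP; split => //; lra.
have qn n : 0 <= q ^+ n <= 1 by rewrite exprn_ge0 ?exprn_ile1//; case/andP: q1.
(* The lower bound 1 - (2q)^n is Bernoulli's inequality with N = 2^n and z = q^n. *)
apply: (@squeeze_cvgr _ _ _ _ (fun n => 1 - (2 * q) ^+ n) (fun=> 1)).
- apply: nearW => n; apply/andP; split.
    by rewrite exprMn -natrX; exact: bernoulli_onem.
  by apply: exprn_ile1; have := qn n; lra.
- rewrite -[X in _ --> X]subr0; apply: cvgB; first exact: cvg_cst.
  by apply: cvg_expr; rewrite ger0_norm; lra.
- exact: cvg_cst.
Qed.

Lemma step_cvg0 (q : R) : 2^-1 < q <= 1 ->
  (fun n => (1 - q ^+ n) ^+ (2 ^ n)) @ \oo --> (0 : R).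
Proof.
move=> /andP[q2 q1].
have q0 : 0 <= q by lra.
have qn n : 0 <= q ^+ n <= 1 by rewrite exprn_ge0 ?exprn_ile1.
(* [onemX_mul_le1] with N = 2^n and z = q^n bounds the power by 1 / (1 + (2q)^n), hence by (2q)^-n,
   which tends to 0. *)
apply: (@squeeze_cvgr _ _ _ _ (fun=> 0) (fun n => ((2 * q)^-1) ^+ n)).
- apply: nearW => n; apply/andP; split.
    by apply: exprn_ge0; have := qn n; lra.
  have := @onemX_mul_le1 (q ^+ n) (2 ^ n) (qn n).
  rewrite natrX -exprMn exprVn => h.
  have q2n : 0 < (2 * q) ^+ n by apply: exprn_gt0; lra.
  rewrite -[leRHS]mul1r ler_pdivlMr//; apply: le_trans h; apply: ler_wpM2l.
    by apply: exprn_ge0; have := qn n; lra.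
  lra.
- exact: cvg_cst.
- apply: cvg_expr; rewrite ger0_norm; last by rewrite invr_ge0; lra.
  by rewrite invf_lt1; lra.
Qed.

(** It suffices to separate [E] from its complement by the sign of a trigonometric polynomial: (1 -
    P)/2 is then below 1/2 on [E] and above 1/2 off it, so the Brosowski-Deutsch powers tend to the
    indicator almost everywhere, and dominated convergence gives the L^1 estimate. *)
Lemma trig_approx_step (P : R -> R) E : measurable E -> trigpoly P ->
  (forall x, -1 <= P x <= 1) ->
  ae_T (fun x => (E x -> 0 < P x) /\ (~ E x -> P x < 0)) -> trig_approx E.
Proof.
move=> mE tP P1 aeP eps eps0.
pose q x := 2^-1 * (1 - P x).
have q01 x : 0 <= q x <= 1 by rewrite /q; have := P1 x; lra.
pose Q n x := (1 - q x ^+ n) ^+ (2 ^ n).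
have tQ n : trigpoly (Q n).
  by apply/trigpolyX/trigpoly_onem/trigpolyX/trigpolyZ/trigpoly_onem.
have Q01 n x : 0 <= Q n x <= 1.
  have /andP[a b] := q01 x.
  have c : 0 <= q x ^+ n <= 1 by rewrite exprn_ge0 ?exprn_ile1.
  by rewrite /Q exprn_ge0 ?exprn_ile1//; lra.
have [||| n hn] := @RI_dominated0 (fun n x => \1_E x - Q n x) _ _ _ eps eps0.
- by move=> n; apply: bmeasB; [exact: bmeas_indic|exact: trigpoly_bmeas].
- move=> n x _; have := Q01 n x; rewrite indicE.
  by case: (_ \in _) => /=; rewrite ler_norml; lra.
- apply: ae_T_imp aeP => x Dx [PE PnE].
  have [Ex|nEx] := pselect (E x).
    rewrite -[X in _ --> X](subrr (\1_E x)); apply: cvgB; first exact: cvg_cst.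
    rewrite indicE mem_set//=; apply: step_cvg1.
    by have := PE Ex; have := P1 x; rewrite /q; lra.
  rewrite indicE memNset//=.
  rewrite -[X in _ --> X](subrr 0); apply: cvgB; first exact: cvg_cst.
  apply: step_cvg0.
  by have := PnE nEx; have := P1 x; rewrite /q; lra.
by exists (Q n).
Qed.

Lemma ae_T_neq (a : R) : ae_T (fun x => x != a).
Proof.
exists [set a]; split; [exact: measurable_set1|exact: lebesgue_measure_set1|].
by move=> x [_ /=] /negP; rewrite negbK => /eqP.
Qed.

Lemma trig_approx_ray (a : R) : trig_approx `]a, +oo[%classic.
Proof.
have mE : measurable (`]a, +oo[%classic : set R) by exact: measurable_itv.
(* For [a] negative, or at least 2 pi, the ray contains [D] or misses it, and a constant
   separates. *)
have [a0|a0] := ltP a 0.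
  apply: (@trig_approx_step (fun=> 1)) => //; first exact: trigpoly_cst.
    by move=> x; lra.
  apply: ae_T_all => x /=; rewrite /circD /= !in_itv /= => /andP[x0 _].
  by split => // /negP; rewrite andbT -leNgt; lra.
have [ap|ap] := leP (2 * pi) a.
  apply: (@trig_approx_step (fun=> -1)) => //; first exact: trigpoly_cst.
    by move=> x; lra.
  apply: ae_T_all => x /=; rewrite /circD /= !in_itv /= => /andP[_ x2].
  by split => //; rewrite ?andbT; lra.
(* This equals (cos(a/2) - cos(x - a/2)) / 2, hence has degree one despite the half angles. On the
   open interval from 0 to 2 pi its second factor is positive and its first has the sign of x -
   a. *)
pose P (x : R) := sin (2^-1 * (x - a)) * sin (2^-1 * x).
have PE : P = fun x => 2^-1 * cos (2^-1 * a) +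
    (- 2^-1) * (cos (2^-1 * a) * cos x + sin (2^-1 * a) * sin x).
  apply/funext => x; rewrite /P.
  have -> : x = 2^-1 * x + 2^-1 * x by lra.
  set y := 2^-1 * x; rewrite cosD sinD.
  have -> : 2^-1 * (y + y - a) = y - 2^-1 * a by lra.
  rewrite sinB; set b := 2^-1 * a.
  have : 2^-1 * (y + y) = y by lra.
  move=> ->; have := cos2Dsin2 y; have := cos2Dsin2 b => h1 h2.
  have -> : 2^-1 * cos b = 2^-1 * cos b * (cos y ^+ 2 + sin y ^+ 2).
    by rewrite h2 mulr1.
  by field.
apply: (@trig_approx_step P) => //.
- rewrite PE; apply: trigpolyD; first exact: trigpoly_cst.
  apply: trigpolyZ; apply: trigpolyD; apply: trigpolyZ.
    exact: trigpoly_cos.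
  exact: trigpoly_sin.
- move=> x; rewrite -ler_norml normrM mulr_ile1// sin_max //.
have := ae_T_and (ae_T_neq 0) (ae_T_and (ae_T_neq a) (ae_T_neq (2 * pi))).
apply: ae_T_imp => x; rewrite /circD /= !in_itv /= => /andP[x0 x2] [xn0 [xna xn2]].
have {x0 xn0} x0 : 0 < x by rewrite lt_neqAle eq_sym xn0.
have {x2 xn2} x2 : x < 2 * pi by rewrite lt_neqAle xn2.
have s0 : 0 < sin (2^-1 * x) by apply: sin_gt0_pi; lra.
rewrite andbT; split.
  by move=> ax; rewrite mulr_gt0//; apply: sin_gt0_pi; lra.
move=> /negP; rewrite -leNgt => xa.
have {xna} xa' : x < a by rewrite lt_neqAle xna.
rewrite nmulr_rlt0// -oppr_gt0 -sinN; apply: sin_gt0_pi; lra.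
Qed.

End TrigonometricApproximation.

(** * Density of trigonometric polynomials in L^2 *)

Section TrigonometricDensity.
Variable R : realType.
Implicit Types (u v Q : R -> R) (p q : {poly R[i]}) (E : set R).

Local Notation D := (@circD R).
Local Notation circ := (@circ R).

Lemma trig_approxC E : trig_approx E -> trig_approx (~` E).
Proof.
move=> aE eps eps0; have [Q [tQ Q01 IQ]] := aE _ eps0.
exists (fun x => 1 - Q x); split; first exact: trigpoly_onem.
  by move=> x; have := Q01 x; lra.
apply: le_trans IQ; rewrite le_eqVlt; apply/orP; left; apply/eqP.
apply: eq_RI => x _; rewrite !indicE in_setC -normrN; congr `|_|.
by case: (_ \in _) => /=; lra.
Qed.

Lemma trig_approxI E1 E2 : measurable E1 -> measurable E2 ->
  trig_approx E1 -> trig_approx E2 -> trig_approx (E1 `&` E2).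
Proof.
move=> m1 m2 a1 a2 eps eps0; have e2 : 0 < eps / 2 by lra.
have [Q1 [tQ1 Q101 IQ1]] := a1 _ e2; have [Q2 [tQ2 Q201 IQ2]] := a2 _ e2.
have b1 := trigpoly_bmeas tQ1; have b2 := trigpoly_bmeas tQ2.
have i1 := bmeas_indic m1; have i2 := bmeas_indic m2.
exists (fun x => Q1 x * Q2 x); split; first exact: trigpolyM.
  move=> x; have := Q101 x; have := Q201 x => /andP[? ?] /andP[? ?].
  by rewrite mulr_ge0 ?mulr_ile1.
have -> : eps = eps / 2 + eps / 2 by lra.
apply: le_trans (lerD IQ1 IQ2); rewrite -RID; [|exact/bmeas_norm/bmeasB..].
apply: le_RI.
- apply/bmeas_norm/bmeasB; last exact: bmeasM.
  exact/bmeas_indic/measurableI.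
- by apply: bmeasD; apply/bmeas_norm/bmeasB.
move=> x _; rewrite !indicE in_setI.
(* Telescoping: each error is multiplied by a factor in [0, 1], so the two L^1 errors just add
   up. *)
have -> : ((x \in E1) && (x \in E2))%:R - Q1 x * Q2 x =
   ((x \in E1)%:R - Q1 x) * (x \in E2)%:R + Q1 x * ((x \in E2)%:R - Q2 x) :> R.
  by case: (x \in E1); case: (x \in E2) => /=; ring.
apply: le_trans (ler_normD _ _) _; rewrite !normrM; apply: lerD.
  by rewrite ler_piMr// ger0_norm// lern1 leq_b1.
by rewrite ler_piMl// ger0_norm; have := Q101 x; lra.
Qed.

Lemma trig_approx0 : trig_approx (@set0 R).
Proof.
move=> eps eps0; exists (fun=> 0); split; first exact: trigpoly_cst.
  by move=> x; lra.
rewrite (_ : (fun x => _) = fun=> 0) ?RI_cst ?mul0r ?ltW//.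
by apply/funext => x; rewrite indicE in_set0 subrr normr0.
Qed.

(** Finite unions follow from complements and intersections by De Morgan; their indicators converge
    pointwise to that of the full union, so dominated convergence makes one finite union close
    enough. *)
Lemma trig_approx_bigcup (F : (set R)^nat) : (forall i, measurable (F i)) ->
  (forall i, trig_approx (F i)) -> trig_approx (\bigcup_i F i).
Proof.
move=> mF aF eps eps0; have e2 : 0 < eps / 2 by lra.
pose G n := \big[setU/set0]_(i < n) F i.
have mG n : measurable (G n) by apply: bigsetU_measurable.
have aG n : trig_approx (G n).
  elim: n => [|n IH]; first by rewrite /G big_ord0; exact: trig_approx0.
  rewrite /G big_ord_recr /= -[_ `|` _]setCK setCU; apply: trig_approxC.
  by apply: trig_approxI; [apply: measurableC; exact: mG|exact: measurableC|exact: trig_approxC..].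
have mU : measurable (\bigcup_i F i) by exact: bigcup_measurable.
have [||| n hn] := @RI_dominated0 _ (fun n x => \1_(\bigcup_i F i) x - \1_(G n) x) _ _ _ _ e2.
- by move=> n; apply: bmeasB; exact: bmeas_indic.
- move=> n x _; rewrite !indicE.
  by case: (_ \in _); case: (_ \in _) => /=; rewrite ler_norml; lra.
- apply: ae_T_all => x _; apply: cvg_near_cst.
  have [[k _ Fkx]|nF] := pselect ((\bigcup_i F i) x).
    exists k.+1 => // n /= kn; rewrite !indicE !mem_set ?subrr//; last by exists k.
    by rewrite /G -bigcup_mkord; exists k.
  apply: nearW => n; rewrite !indicE !memNset ?subrr//.
  by rewrite /G -bigcup_mkord => -[k _ Fkx]; apply: nF; exists k.
have [Q [tQ Q01 IQ]] := aG n _ e2; exists Q; split => //.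
have bQ := trigpoly_bmeas tQ.
have iU := bmeas_indic mU; have iG := bmeas_indic (mG n).
have -> : eps = eps / 2 + eps / 2 by lra.
apply: le_trans (lerD hn IQ); rewrite -RID; [|exact/bmeas_norm/bmeasB..].
apply: le_RI; [exact/bmeas_norm/bmeasB|by apply: bmeasD; apply/bmeas_norm/bmeasB|].
move=> x _; apply: le_trans (ler_normD _ _); by rewrite addrA subrK.
Qed.

(** The measurable approximable sets form a sigma-algebra containing the open rays, which generate
    the Borel sets. *)
Lemma trig_approx_measurable E : measurable E -> trig_approx E.
Proof.
move=> mE; suff [] : measurable E /\ trig_approx E by [].
have : (@RGenOInfty.G R).-sigma.-measurable E.
  by rewrite -RGenOInfty.measurableE.
apply: (@smallest_sub _ _ _ (fun A : set R => measurable A /\ trig_approx A)); last first.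
  move=> _ [a ->]; split; first exact: measurable_itv.
  exact: trig_approx_ray.
split.
- by split; [exact: measurable0|exact: trig_approx0].
- move=> A [mA aA]; rewrite setTD; split; first exact: measurableC.
  exact: trig_approxC.
- move=> F hF; split; first by apply: bigcup_measurable => i _; case: (hF i).
  by apply: trig_approx_bigcup => i; case: (hF i).
Qed.

Definition L2trig u : Prop := forall eps : R, 0 < eps ->
  exists2 Q, trigpoly Q & RI (fun x => (u x - Q x) ^+ 2) <= eps.

(** The inequality (s + t)^2 <= 2 s^2 + 2 t^2 replaces the triangle inequality of the L^2 norm. *)
Lemma L2trig_perturb u v (d : R) : bmeas u -> bmeas v ->
  RI (fun x => (u x - v x) ^+ 2) <= d -> 
  forall eps : R, (exists2 Q, trigpoly Q & RI (fun x => (v x - Q x) ^+ 2) <= eps) ->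
  exists2 Q, trigpoly Q & RI (fun x => (u x - Q x) ^+ 2) <= 2 * (d + eps).
Proof.
move=> bu bv hd eps [Q tQ hQ]; exists Q => //; have bQ := trigpoly_bmeas tQ.
have buv := bmeasX 2 (bmeasB bu bv); have bvQ := bmeasX 2 (bmeasB bv bQ).
apply: (@le_trans _ _ (2 * (RI (fun x => (u x - v x) ^+ 2) + RI (fun x => (v x - Q x) ^+ 2)))).
  rewrite -RID// -RIZ; last exact: bmeasD.
  apply: le_RI; [exact/bmeasX/bmeasB|exact/bmeasZ/bmeasD|move=> x _].
  have -> : u x - Q x = (u x - v x) + (v x - Q x) by lra.
  by have := sqr_ge0 ((u x - v x) - (v x - Q x)); lra.
by rewrite ler_pM2l// lerD.
Qed.

(** The error is at most 1 in absolute value, so its square is at most its absolute value. *)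
Lemma L2trig_indic E : measurable E -> L2trig (\1_E).
Proof.
move=> mE eps eps0; have [Q [tQ Q01 IQ]] := trig_approx_measurable mE eps0.
have bQ := trigpoly_bmeas tQ; have iE := bmeas_indic mE.
exists Q => //; apply: le_trans IQ; apply: le_RI.
- exact/bmeasX/bmeasB.
- exact/bmeas_norm/bmeasB.
move=> x _; rewrite -real_normK ?num_real// expr2 ler_piMr//.
by rewrite indicE ler_norml; have := Q01 x; case: (_ \in _) => /=; lra.
Qed.

Lemma L2trigD u v : bmeas u -> bmeas v -> L2trig u -> L2trig v ->
  L2trig (fun x => u x + v x).
Proof.
move=> bu bv au av eps eps0; have e4 : 0 < eps / 4 by lra.
have [Q1 t1 h1] := au _ e4; have [Q2 t2 h2] := av _ e4.
have b1 := trigpoly_bmeas t1; have b2 := trigpoly_bmeas t2.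
exists (fun x => Q1 x + Q2 x); first exact: trigpolyD.
have -> : eps = 2 * (eps / 4 + eps / 4) by lra.
apply: (@le_trans _ _ (2 * (RI (fun x => (u x - Q1 x) ^+ 2) + RI (fun x => (v x - Q2 x) ^+ 2)))).
  have c1 := bmeasX 2 (bmeasB bu b1); have c2 := bmeasX 2 (bmeasB bv b2).
  rewrite -RID// -RIZ; last exact: bmeasD.
  apply: le_RI; [by apply/bmeasX/bmeasB; exact: bmeasD|exact/bmeasZ/bmeasD|move=> x _].
  by have := sqr_ge0 ((u x - Q1 x) - (v x - Q2 x)); lra.
by rewrite ler_pM2l// lerD.
Qed.

Lemma L2trigZ (c : R) u : bmeas u -> L2trig u -> L2trig (fun x => c * u x).
Proof.
(* Adding 1 to c^2 lets the tolerance eps / (c^2 + 1) cover c = 0 as well. *)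
move=> bu au eps eps0; have c0 : 0 < c ^+ 2 + 1 by rewrite ltr_wpDl ?sqr_ge0.
have [Q t h] := au _ (divr_gt0 eps0 c0).
have b := trigpoly_bmeas t; exists (fun x => c * Q x); first exact: trigpolyZ.
rewrite (_ : (fun x => _) = fun x => c ^+ 2 * (u x - Q x) ^+ 2); last first.
  by apply/funext => x; ring.
rewrite RIZ; last exact/bmeasX/bmeasB.
apply: (@le_trans _ _ (c ^+ 2 * (eps / (c ^+ 2 + 1)))).
  by rewrite ler_wpM2l ?sqr_ge0.
by rewrite mulrCA ler_piMr ?(ltW eps0)// ler_pdivrMr//; lra.
Qed.

Lemma L2trig_cst (c : R) : L2trig (fun=> c).
Proof.
move=> eps eps0; exists (fun=> c); first exact: trigpoly_cst.
by rewrite subrr expr0n RI_cst mul0r ltW.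
Qed.

Lemma L2trig_sum (I : Type) (s : seq I) (F : I -> R -> R) :
  (forall i, bmeas (F i)) -> (forall i, L2trig (F i)) ->
  L2trig (fun x => \sum_(i <- s) F i x).
Proof.
move=> bF aF; elim: s => [|i s IH].
  by under eq_fun do rewrite big_nil; exact: L2trig_cst.
by under eq_fun do rewrite big_cons; apply: L2trigD => //; exact: bmeas_sum.
Qed.

(** The sum counts the integers from 1 to [N] that are at most [y]; as y < N + 1, it is the integer
    part of [y]. *)
Lemma layer_cake (y : R) N : 0 <= y -> y < N.+1%:R ->
  `|y - \sum_(j < N) (j.+1%:R <= y)%R%:R| <= 1.
Proof.
move=> y0; elim: N => [|N IH] yN.
  by rewrite big_ord0 subr0 ger0_norm// ltW.
have [yN'|Ny] := ltP y N.+1%:R.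
  by rewrite big_ord_recr /= [N.+1%:R <= y]leNgt yN' /= addr0; exact: IH.
rewrite (eq_bigr (fun=> 1)) => [|j _]; last first.
  by rewrite (le_trans _ Ny)// ler_nat.
rewrite big_const_ord iter_addr_0 -natr1 ler_norml.
by move: yN Ny; rewrite -!natr1; lra.
Qed.

Lemma L2trig_bmeas u : bmeas u -> L2trig u.
Proof.
move=> bu eps eps0; have [mu [M uM]] := bu.
(* The mesh satisfies d <= 1 and 8 pi d <= eps, whence 2 pi d^2 <= eps / 4. *)
pose d := Num.min 1 (eps / (8 * pi)).
have p0 : 0 < pi :> R := pi_gt0 R.
have d0 : 0 < d by rewrite lt_min ltr01 divr_gt0// mulr_gt0.
(* [E j] is the set where (u + M)/d is at least j + 1, so the staircase [v] below rounds u + M down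
   to a multiple of [d] and stays within [d] of [u]. *)
pose E (j : nat) : set R := D `&` [set x | j.+1%:R * d - M <= u x].
have mE j : measurable (E j).
  by have := @measurable_circD R => mD; apply: measurable_fun_le => //; exact: measurable_cst.
have [N MN] : exists N : nat, 2 * M / d < N.+1%:R.
  by exists (Num.truncn (2 * M / d)); exact: truncnS_gt.
pose v x := - M + \sum_(j < N) d * \1_(E j) x.
have bE j : bmeas (fun x => d * \1_(E j) x) by exact/bmeasZ/bmeas_indic.
have bv : bmeas v by apply: bmeasD; [exact: bmeas_cst|exact: bmeas_sum].
have uv x : D x -> (u x - v x) ^+ 2 <= d ^+ 2.
  move=> Dx; have /andP[u1 u2] : - M <= u x <= M by rewrite -ler_norml uM.
  have := @layer_cake ((u x + M) / d) N.
  have uM0 : 0 <= u x + M by lra.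
  rewrite (divr_ge0 uM0 (ltW d0)).
  move=> /(_ isT); rewrite ltr_pdivrMr// => h.
  have /h {h} : u x + M < N.+1%:R * d by rewrite ltr_pdivrMr// in MN; lra.
  rewrite (eq_bigr (fun j : 'I_N => \1_(E j) x)) => [|j _]; last first.
    rewrite indicE ler_pdivlMr//; congr (_%:R); congr nat_of_bool.
    apply/idP/idP => [h|/set_mem [_ /=]]; last by lra.
    by rewrite mem_set//; split => //=; lra.
  move=> h; have -> : u x - v x = d * ((u x + M) / d - \sum_(j < N) \1_(E j) x).
    by rewrite /v -mulr_sumr; field; rewrite gt_eqF.
  rewrite exprMn ler_piMr ?sqr_ge0// -real_normK ?num_real// exprn_ile1//.
have Iuv : RI (fun x => (u x - v x) ^+ 2) <= eps / 4.
  apply: (@le_trans _ _ (d ^+ 2 * (2 * pi))).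
    by rewrite -RI_cst; apply: le_RI => //; [exact/bmeasX/bmeasB|exact: bmeas_cst].
  have d1 : d <= 1 by rewrite ge_min lexx.
  have d2 : d * (8 * pi) <= eps by rewrite -ler_pdivlMr ?mulr_gt0// ge_min lexx orbT.
  by rewrite expr2; nra.
have av : L2trig v.
  apply: L2trigD; [exact: bmeas_cst|exact: bmeas_sum|exact: L2trig_cst|].
  apply: L2trig_sum => // j; apply: L2trigZ; first exact: bmeas_indic.
  exact: L2trig_indic.
have e4 : 0 < eps / 4 by lra.
have := L2trig_perturb bu bv Iuv (av _ e4).
by have -> : 2 * (eps / 4 + eps / 4) = eps by lra.
Qed.

End TrigonometricDensity.

(** * Bounded Hardy functions: analytic approximation and closure under products *)

Section BoundedHardy.
Variable R : realType.
Implicit Types (f g h : R -> R[i]) (p q : {poly R[i]}).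

Local Notation D := (@circD R).
Local Notation circ := (@circ R).

(* [H^oo] restricted to functions bounded everywhere on [circD], not just almost
   everywhere; [inHinf_hb] and [hb_inHinf] relate it to [inHinf]. *)
Definition hb f : Prop := cb f /\ forall n, cI (fun x => f x * circ x ^+ n.+1) = 0.

(** All positive powers of [circ] integrate to 0 against [f], so only the constant coefficient
    survives. *)
Lemma hb_horner f p : hb f -> cI (fun x => f x * p.[circ x]) = cI f * p`_0.
Proof.
move=> [bf f0].
(* The extra power of [circ] absorbs the shift caused by each ['X] in the induction on [q]. *)
have H q n : cI (fun x => f x * (q.[circ x] * circ x ^+ n.+1)) = 0.
  elim/poly_ind: q n => [|q a IH] n.
    under eq_fun do rewrite horner0 mul0r mulr0.
    by rewrite cI_cst mul0r.
  rewrite (_ : (fun x => _) = fun x => f x * (q.[circ x] * circ x ^+ n.+2) +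
      a * (f x * circ x ^+ n.+1)); last first.
    by apply/funext => x; rewrite hornerMXaddC !exprS; ring.
  have b1 := cbM bf (@cb_circX R n.+1).
  rewrite cID ?IH ?cIZ ?f0 ?mulr0 ?addr0//; last exact: cbZ.
  by apply: cbM => //; apply: cbM; [exact: cb_hcirc|exact: cb_circX].
elim/poly_ind: p => [|p a _].
  under eq_fun do rewrite horner0 mulr0.
  by rewrite cI_cst coef0 mul0r mulr0.
rewrite (_ : (fun x => _) = fun x => f x * (p.[circ x] * circ x ^+ 1) + a * f x); last first.
  by apply/funext => x; rewrite hornerMXaddC expr1; ring.
rewrite cID ?H ?cIZ//; last exact: cbZ.
  by rewrite coefD coefMX coefC /= !add0r mulrC.
by apply: cbM => //; apply: cbM; [exact: cb_hcirc|exact: cb_circX].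
Qed.

Lemma hb_cst (c : R[i]) : hb (fun=> c).
Proof.
split; first exact: cb_cst.
by move=> n; rewrite cIZ ?cI_circX ?mulr0//; exact: cb_circX.
Qed.

Lemma cI_hcirc p : cI (fun x => p.[circ x]) = (2 * pi)%:C%C * p`_0.
Proof.
rewrite -[(2 * pi)%:C%C]mul1r -cI_cst -hb_horner; last exact: hb_cst.
by congr cI; apply/funext => x; rewrite mul1r.
Qed.

Lemma hbD f g : hb f -> hb g -> hb (fun x => f x + g x).
Proof.
move=> [bf f0] [bg g0]; split=> [|n]; first exact: cbD.
under eq_fun do rewrite mulrDl.
by rewrite cID ?f0 ?g0 ?addr0//; apply: cbM => //; exact: cb_circX.
Qed.

Lemma hbZ (c : R[i]) f : hb f -> hb (fun x => c * f x).
Proof.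
move=> [bf f0]; split=> [|n]; first exact: cbZ.
under eq_fun do rewrite -mulrA.
by rewrite cIZ ?f0 ?mulr0//; apply: cbM => //; exact: cb_circX.
Qed.

(** A weak Cauchy-Schwarz inequality, read off from the nonnegative integral of |f - c conj g|^2
    with c = z / (B + 1). The added 1 avoids a separate case for B = 0. *)
Lemma cI_mul_le f g : cb f -> cb g ->
  cnorm2 (cI (fun x => f x * g x)) <=
  RI (fun x => cnorm2 (f x)) * (RI (fun x => cnorm2 (g x)) + 1).
Proof.
move=> bf bg; set z := cI _; set A := RI _; set B := RI (fun x => cnorm2 (g x)).
have B0 : 0 <= B by apply: RI_ge0 => x _; exact: cnorm2_ge0.
pose t := (B + 1)^-1; have t0 : 0 < t by rewrite invr_gt0; lra.
pose c := t%:C%C * z.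
have bfg := cbM bf bg; have bc := cbZ (conjc c) bfg.
have bA := bmeas_cnorm2 bf; have bB := bmeas_cnorm2 bg.
have : 0 <= RI (fun x => cnorm2 (f x - c * conjc (g x))).
  by apply: RI_ge0 => x _; exact: cnorm2_ge0.
rewrite (_ : (fun x => _) = fun x => cnorm2 (f x) + (- 2 * Re (conjc c * (f x * g x)) +
    cnorm2 c * cnorm2 (g x))); last first.
  by apply/funext => x; rewrite /cnorm2 !complexPartsE; ring.
have bcR : bmeas (fun x => Re (conjc c * (f x * g x))) by case: bc.
have bc2 := bmeasZ (- 2) bcR; have bB2 := bmeasZ (cnorm2 c) bB.
rewrite RID//; last exact: bmeasD.
rewrite [X in _ <= _ + X -> _]RID// RIZ// RIZ// -/A -/B.
have -> : RI (fun x => Re (conjc c * (f x * g x))) = Re (conjc c * z).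
  by rewrite /z -cIZ.
have -> : Re (conjc c * z) = t * cnorm2 z by rewrite /c /cnorm2 !complexPartsE /=; ring.
have -> : cnorm2 c = t ^+ 2 * cnorm2 z.
  by rewrite cnorm2M; congr (_ * _); rewrite /cnorm2 /= expr0n /= addr0.
have N0 := cnorm2_ge0 z.
have tB : t * B <= 1 by rewrite /t mulrC ler_pdivrMr; lra.
have tN : 0 <= t * cnorm2 z by rewrite mulr_ge0// ltW.
have h1 : t * cnorm2 z * (t * B) <= t * cnorm2 z by rewrite ler_piMr.
move=> h; have : t * cnorm2 z <= A by rewrite expr2 in h; lra.
by rewrite /t mulrC ler_pdivrMr; lra.
Qed.

(** Approximating the parts of [f] by Re p1 and Re p2, one has Re p1 + i Re p2 = (p1 + i p2)/2 +
    conj ((p1 - i p2)/2), an analytic plus an anti-analytic polynomial. *)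
Lemma L2_hcirc f (eps : R) : cb f -> 0 < eps -> exists p q,
  RI (fun x => cnorm2 (f x - (p.[circ x] + conjc (circ x * q.[circ x])))) <= eps.
Proof.
move=> [b1 b2] eps0; have e2 : 0 < eps / 2 by lra.
have [Q1 t1 h1] := L2trig_bmeas b1 e2; have [Q2 t2 h2] := L2trig_bmeas b2 e2.
have c1 := trigpoly_bmeas t1; have c2 := trigpoly_bmeas t2.
have [p1 E1] := t1; have [p2 E2] := t2.
pose S : {poly R[i]} := (2^-1)%:C%C *: (p1 - ('i)%C *: p2).
(* The constant term [c] of [S] moves to the analytic part, leaving strictly negative frequencies in
   the other one. *)
have [q [c Sqc]] : exists q c, S = q * 'X + c%:P.
  by elim/poly_ind: S => [|q c _]; [exists 0, 0; rewrite mul0r addr0|exists q, c].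
exists ((2^-1)%:C%C *: (p1 + ('i)%C *: p2) + (conjc c)%:P), q.
have -> : eps = eps / 2 + eps / 2 by lra.
apply: le_trans (lerD h1 h2).
rewrite -RID; [|exact/bmeasX/bmeasB..].
rewrite le_eqVlt; apply/orP; left; apply/eqP; apply: eq_RI => x _.
have : conjc (circ x * q.[circ x]) = conjc S.[circ x] - conjc c.
  by rewrite Sqc hornerMXaddC conjcD addrK mulrC.
move=> ->; rewrite /cnorm2 E1 E2 /S !(hornerD, hornerZ, hornerN, hornerC).
by congr (_ ^+ 2 + _ ^+ 2); rewrite !complexPartsE /=; field.
Qed.

(** Pythagoras: g = f - p is again in [hb], hence orthogonal to the conjugate of w = circ * q, and
    the integral of |g - conj w|^2 is the sum of those of |g|^2 and |w|^2. *)
Lemma hb_approx f (eps : R) : hb f -> 0 < eps -> exists p,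
  RI (fun x => cnorm2 (f x - p.[circ x])) <= eps.
Proof.
move=> hf eps0; have [bf _] := hf; have [p [q pq]] := L2_hcirc bf eps0.
exists p; apply: le_trans pq.
have hg : hb (fun x => f x - p.[circ x]).
  apply: hbD => //; split; first exact/cbN/cb_hcirc.
  move=> n; rewrite (_ : (fun x => _) = fun x => - ((p * 'X^(n.+1)).[circ x])).
    by rewrite cIN ?cI_hcirc ?coefMXn ?mulr0 ?oppr0//; exact: cb_hcirc.
  by apply/funext => x; rewrite hornerM hornerXn mulNr.
have [bg _] := hg; set g := (fun x => f x - p.[circ x]) in hg bg *.
pose w x := circ x * q.[circ x].
have bw : cb w by apply: cbM; [exact: cb_circ|exact: cb_hcirc].
have I0 : RI (fun x => Re (g x * w x)) = 0.
  suff : cI (fun x => g x * w x) = 0 by move/(congr1 (@complex.Re _)).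
  have := hb_horner ('X * q) hg; rewrite coefXM mulr0 => <-.
  by congr cI; apply/funext => x; rewrite hornerM hornerX.
have bgw := cbM bg bw; have bg2 := bmeas_cnorm2 bg; have bw2 := bmeas_cnorm2 bw.
rewrite [leRHS](_ : _ = RI (fun x => cnorm2 (g x) + (- 2 * Re (g x * w x) + cnorm2 (w x)))).
  rewrite RID//; last by apply: bmeasD => //; apply: bmeasZ; case: bgw.
  rewrite [X in _ <= _ + X]RID//; last by apply: bmeasZ; case: bgw.
  rewrite RIZ; last by case: bgw.
  rewrite I0 mulr0 add0r lerDl; apply: RI_ge0 => x _; exact: cnorm2_ge0.
by apply: eq_RI => x _; rewrite -/(w x) opprD addrA -/(g x) /cnorm2 !complexPartsE; ring.
Qed.

(** By [cI_mul_le], an integral that can be rewritten with an arbitrarily L^2-small factor against a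
    fixed [g] must vanish. *)
Lemma cb_small0 f g : cb f -> cb g -> 
  (forall eps : R, 0 < eps -> exists2 u, cb u /\ RI (fun x => cnorm2 (u x)) <= eps &
     cI f = cI (fun x => u x * g x)) -> cI f = 0.
Proof.
move=> bf bg H; apply/eqP; rewrite -cnorm2_eq0 eq_le cnorm2_ge0 andbT.
set B := RI (fun x => cnorm2 (g x)) + 1.
have B0 : 0 < B by rewrite ltr_wpDl// RI_ge0// => x _; exact: cnorm2_ge0.
apply/ler_addgt0Pl => eps eps0; rewrite addr0.
have [u [bu hu] ->] := H _ (divr_gt0 eps0 B0).
apply: (le_trans (cI_mul_le bu bg)); rewrite -/B -ler_pdivlMr//.
Qed.

(** With [f] replaced by a polynomial, the integral vanishes by [hb_horner] applied to [g]; the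
    remainder carries the L^2-small factor f - p. *)
Lemma hbM f g : hb f -> hb g -> hb (fun x => f x * g x).
Proof.
move=> hf hg; have [bf _] := hf; have [bg _] := hg; split; first exact: cbM.
move=> n; have be := @cb_circX R n.+1; have bge := cbM bg be.
under eq_fun do rewrite -mulrA.
apply: (@cb_small0 _ (fun x => g x * circ x ^+ n.+1)) => //; first exact: cbM.
move=> eps eps0; have [p hp] := hb_approx hf eps0.
have bp := cb_hcirc p; exists (fun x => f x - p.[circ x]); first by split => //; exact: cbB.
under [in RHS]eq_fun do rewrite mulrBl.
rewrite cIB; [|exact: cbM..].
rewrite (_ : cI (fun x => p.[circ x] * _) = 0) ?subr0//.
have := hb_horner (p * 'X^(n.+1)) hg; rewrite coefMXn /= mulr0 => <-.
by congr cI; apply/funext => x; rewrite hornerM hornerXn; ring.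
Qed.

(** Such an [f] is orthogonal to every analytic polynomial and yet an L^2 limit of them, so the
    integral of |f|^2 is 0. *)
Lemma hb_coef0 f : hb f -> (forall n, cI (fun x => f x * conjc (circ x) ^+ n) = 0) ->
  ae_T (fun x => f x = 0).
Proof.
move=> hf f0; have [bf _] := hf; have bfJ := cbJ bf.
have bn := bmeas_cnorm2 bf.
suff I0 : cI (fun x => conjc (f x) * f x) = 0.
  have : RI (fun x => cnorm2 (f x)) = 0.
    move/(congr1 (@complex.Re _)): I0 => /= <-.
    by congr RI; apply/funext => x; rewrite mulJc.
  move/(RI_eq0_ae bn) => /(_ (fun x _ => cnorm2_ge0 _)).
  by apply: ae_T_imp => x _ /eqP; rewrite cnorm2_eq0 => /eqP.
apply: (@cb_small0 _ f) => //; first exact: cbM.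
move=> eps eps0; have [p hp] := hb_approx hf eps0; have bp := cb_hcirc p.
exists (fun x => conjc (f x - p.[circ x])).
  split; first exact/cbJ/cbB.
  apply: le_trans hp; rewrite le_eqVlt; apply/orP; left; apply/eqP.
  by apply: eq_RI => x _; rewrite /cnorm2 RecJ ImcJ sqrrN.
have bpJ := cbJ bp; have bN := cbN bpJ.
rewrite [in RHS](_ : (fun x => _) = fun x => conjc (f x) * f x - f x * conjc p.[circ x]).
  rewrite cIB; [|exact: cbM..].
  rewrite (_ : cI (fun x => f x * _) = 0) ?subr0//.
  suff H n : cI (fun x => f x * (conjc p.[circ x] * conjc (circ x) ^+ n)) = 0.
    by rewrite -(H 0%N); congr cI; apply/funext => x; rewrite expr0 mulr1.
  have bJ q m : cb (fun x => conjc q.[circ x] * conjc (circ x) ^+ m).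
    by apply: cbM; [exact/cbJ/cb_hcirc|exact/cbX/cbJ/cb_circ].
  elim/poly_ind: p {hp bp bpJ bN} n => [|q a IH] n.
    under eq_fun do rewrite horner0 conjc0 mul0r mulr0.
    by rewrite cI_cst mul0r.
  rewrite (_ : (fun x => _) = fun x => f x * (conjc q.[circ x] * conjc (circ x) ^+ n.+1) +
      conjc a * (f x * conjc (circ x) ^+ n)); last first.
    by apply/funext => x; rewrite hornerMXaddC conjcD conjcM exprS; ring.
  have b1 : cb (fun x => f x * conjc (circ x) ^+ n).
    by apply: cbM => //; exact/cbX/cbJ/cb_circ.
  rewrite cID ?IH ?cIZ ?f0 ?mulr0 ?addr0//; last exact: cbZ.
  exact: cbM.
by apply/funext => x; rewrite conjcD rmorphN /= mulrDl mulNr; congr (_ - _); rewrite mulrC.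
Qed.

End BoundedHardy.

(** * Boundary uniqueness: zero sets of bounded Hardy functions *)

Section BoundaryUniqueness.
Variable R : realType.
Implicit Types (f g h : R -> R[i]) (p q : {poly R[i]}) (E : set R).

Local Notation D := (@circD R).
Local Notation circ := (@circ R).

(** This is 1 - y <= exp(-y) multiplied by exp y. *)
Lemma expR_leDM (y : R) : expR y <= 1 + y * expR y.
Proof.
have := expR_ge1Dx (- y); rewrite expRN => h.
have e0 := expR_gt0 y.
have : (1 + - y) * expR y <= 1 by rewrite -ler_pdivlMr// mul1r.
by lra.
Qed.

Lemma bernoulli_onep (z : R) N : 0 <= z -> 1 + N%:R * z <= (1 + z) ^+ N.
Proof.
move=> z0; elim: N => [|N IH]; first by rewrite mul0r addr0 expr0.
rewrite exprS; apply: (@le_trans _ _ ((1 + z) * (1 + N%:R * z))); last first.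
  by rewrite ler_wpM2l// addr_ge0.
rewrite -natr1; have : 0 <= N%:R * z * z by rewrite !mulr_ge0.
by move=> h; nra.
Qed.

(** |1 + w/n|^2 = 1 + (2 Re w)/n + |w|^2/n^2 is at most the exponential of its last two terms; then
    take the n-th power. *)
Lemma cnorm2_oneD_le (w : R[i]) (n : nat) : (0 < n)%N ->
  cnorm2 ((1 + (n%:R^-1)%:C%C * w) ^+ n) <= expR (2 * Re w + cnorm2 w / n%:R).
Proof.
move=> n0; have nR : n%:R != 0 :> R by rewrite pnatr_eq0 -lt0n.
rewrite cnorm2X.
have -> : 2 * Re w + cnorm2 w / n%:R =
  n%:R * (n%:R^-1 * (2 * Re w) + cnorm2 w * n%:R^-1 ^+ 2) by field.
rewrite expRM_natl; apply: lerXn2r; rewrite ?nnegrE ?cnorm2_ge0 ?expR_ge0//.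
apply: le_trans (expR_ge1Dx _); rewrite le_eqVlt; apply/orP; left; apply/eqP.
by case: w => u v; rewrite /cnorm2 /=; ring.
Qed.

(* With [Q = Re q] close to the indicator of [E], the analytic polynomials
   [(1 + L q / n)^n] approximate [exp (L q)]: they have modulus about 1 off [E],
   where [f] lives, while their mean value is at least [1 + L |E| / (4 pi)]. *)
Lemma hb_vanish_null f E : hb f -> cI f = 1 -> measurable E ->
  (forall x, D x -> E x -> f x = 0) -> RI (\1_E) = 0.
Proof.
move=> hf If mE fE; have [bf _] := hf; have iE := bmeas_indic mE.
apply/eqP; rewrite eq_le RI_ge0 ?andbT => [|x _]; last by rewrite indicE.
rewrite leNgt; apply/negP; set m := RI (\1_E) => m0.
have p0 : 0 < pi :> R := pi_gt0 R.
have [M M0 fM] : exists2 M : R, 0 < M & forall x, D x -> cnorm2 (f x) <= M ^+ 2.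
  have [_ [K fK]] := bmeas_cnorm2 bf; exists (`|K| + 1).
    by have := normr_ge0 K; lra.
  move=> x Dx; have := fK x Dx; have := ler_norm (cnorm2 (f x)); have := ler_norm K.
  by have := normr_ge0 K; nra.
(* [B] will bound the integral of |f r| for every [L], whereas [L] is chosen so that L m / (4 pi) =
   B + 1. *)
pose B := M * expR (2^-1) * (2 * pi + 1).
have B0 : 0 < B by rewrite !mulr_gt0 ?expR_gt0//; lra.
pose L := (B + 1) * (4 * pi) / m.
have L0 : 0 < L by rewrite divr_gt0// mulr_gt0//; lra.
pose C := L * expR L.
have C0 : 0 < C by rewrite mulr_gt0// expR_gt0.
(* The first bound keeps [C] times the L^1 error at most 1; the second keeps the integral of [Q] at
   least m/2. *)
pose eta := Num.min C^-1 (m / 2).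
have eta0 : 0 < eta by rewrite lt_min invr_gt0 C0 /=; lra.
have [Q [tQ Q01 IQ]] := trig_approx_measurable mE eta0.
have bQ := trigpoly_bmeas tQ; have biQ := bmeas_norm (bmeasB iE bQ).
have [p pE] := tQ.
pose a := Re p`_0.
(* Removing an imaginary constant leaves the real part on the circle unchanged and makes q(0) real,
   so Bernoulli's inequality applies to r(0). *)
pose q := p - (Complex 0 (Im p`_0))%:P.
have qE x : Re q.[circ x] = Q x by rewrite /q hornerD hornerN hornerC RecD /= subr0 pE.
have q0 : q`_0 = a%:C%C.
  rewrite /q coefB coefC /= /a; apply: complex_ext; rewrite !complexPartsE /=; lra.
have aQ : 2 * pi * a = RI Q.
  have := congr1 (@complex.Re _) (cI_hcirc p); rewrite RecM /= mul0r subr0 => <-.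
  by congr RI; apply/funext => x; rewrite pE.
have am : m / (4 * pi) <= a.
  have : m - RI Q <= eta.
    apply: le_trans IQ; rewrite -RIB//; apply: le_trans (ler_norm _) _.
    by apply: norm_RI; exact: bmeasB.
  rewrite -aQ; have : eta <= m / 2 by rewrite ge_min lexx orbT.
  by move=> h1 h2; rewrite ler_pdivrMr; nra.
have a0 : 0 < a by apply: lt_le_trans am; rewrite divr_gt0// mulr_gt0.
have bq := cb_hcirc q.
have [_ [K qK]] := bmeas_cnorm2 bq.
(* So large that L^2 |q|^2 / n <= 1 on [D]; this error costs the factor exp(1/2) in the modulus of
   [r]. *)
pose n := (Num.truncn (L ^+ 2 * K)).+1.
have nK : L ^+ 2 * K < n%:R by exact: truncnS_gt.
have n0 : 0 < n%:R :> R by rewrite ltr0n.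
pose r := (1 + (L / n%:R)%:C%C *: q) ^+ n.
have r0 : 1 + L * a <= Re r`_0.
  rewrite -horner_coef0 /r horner_exp hornerD hornerZ [q.[0]]horner_coef0 q0 hornerC.
  have -> : 1 + (L / n%:R)%:C%C * a%:C%C = (1 + L / n%:R * a)%:C%C :> R[i].
    by apply: complex_ext; rewrite !complexPartsE /=; ring.
  rewrite -rmorphXn /=.
  have z0 : 0 <= L / n%:R * a.
    by apply: mulr_ge0; [apply: divr_ge0|]; exact: ltW.
  apply: le_trans (bernoulli_onep n z0).
  by rewrite le_eqVlt; apply/orP; left; apply/eqP; field; rewrite gt_eqF.
have rE x : D x -> cnorm2 r.[circ x] <= (expR (2^-1) * expR (L * Q x)) ^+ 2.
  move=> Dx; rewrite /r horner_exp hornerD hornerZ hornerC.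
  have -> : (L / n%:R)%:C%C * q.[circ x] = (n%:R^-1)%:C%C * (L%:C%C * q.[circ x]).
    by apply: complex_ext; case: (q.[_]) => ? ? /=; ring.
  apply: le_trans (cnorm2_oneD_le _ _) _ => //.
  rewrite -expRD -expRM_natl ler_expR RecM /= mul0r subr0 qE cnorm2M.
  have -> : cnorm2 (L%:C%C : R[i]) = L ^+ 2 by rewrite /cnorm2 /= expr0n /= addr0.
  have : L ^+ 2 * cnorm2 q.[circ x] / n%:R <= 1.
    rewrite ler_pdivrMr// mul1r; apply: ltW; apply: le_lt_trans nK.
    by rewrite ler_wpM2l ?sqr_ge0//; apply: le_trans (ler_norm _) (qK _ Dx).
  by lra.
have bfr := cbM bf (cb_hcirc r).
have : 1 + L * a <= B.
  apply: le_trans r0 _; rewrite -[r`_0]mul1r -If -hb_horner//=.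
  (* On [E] the integrand is 0. Off [E] the error is [Q] itself, and exp(LQ) <= 1 + LQ exp(LQ) <= 1
     + CQ. *)
  apply: (@le_trans _ _ (RI (fun x => M * expR (2^-1) * (1 + C * `|\1_E x - Q x|)))).
    apply: le_RI; [by case: bfr| |].
      by apply: bmeasZ; apply: bmeasD; [exact: bmeas_cst|exact: bmeasZ].
    move=> x Dx; have eM : 0 < M * expR (2^-1) by rewrite mulr_gt0 ?expR_gt0.
    have [Ex|nEx] := pselect (E x).
      rewrite fE// mul0r /=; apply: mulr_ge0; first exact: ltW.
      by apply: addr_ge0 => //; apply: mulr_ge0 => //; exact: ltW.
    rewrite indicE memNset//= sub0r normrN ger0_norm; last by have := Q01 x; lra.
    apply: (@le_trans _ _ (M * expR (2^-1) * expR (L * Q x))).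
      have e0 := expR_gt0 (L * Q x).
      apply: le_trans (ler_norm _) _; rewrite -[leRHS]ger0_norm; last by rewrite mulr_ge0// ltW.
      rewrite -ler_sqr ?nnegrE// !real_normK ?num_real// -mulrA exprMn.
      apply: (@le_trans _ _ (cnorm2 (f x * r.[circ x]))).
        by rewrite lerDl sqr_ge0.
      by rewrite cnorm2M ler_pM ?cnorm2_ge0 ?fM ?rE.
    rewrite ler_pM2l//; apply: le_trans (expR_leDM _) _; rewrite lerD2l /C.
    have /andP[Qx0 Qx1] := Q01 x.
    rewrite [leRHS]mulrAC; apply: ler_wpM2l; first by rewrite mulr_ge0// ltW.
    by rewrite ler_expR ler_piMr// ltW.
  rewrite RIZ; last by apply: bmeasD; [exact: bmeas_cst|exact: bmeasZ].
  rewrite RID; [|exact: bmeas_cst|exact: bmeasZ].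
  rewrite RI_cst RIZ// mul1r /B ler_pM2l ?mulr_gt0 ?expR_gt0// lerD2l.
  have : eta <= C^-1 by rewrite ge_min lexx.
  move=> h; apply: (@le_trans _ _ (C * C^-1)); last by rewrite divff ?gt_eqF.
  by rewrite ler_pM2l// (le_trans IQ).
apply/negP; rewrite -ltNge.
have : L * (m / (4 * pi)) <= L * a by rewrite ler_pM2l.
have -> : L * (m / (4 * pi)) = B + 1 by rewrite /L mulrA divfK ?mulfK ?gt_eqF ?mulr_gt0.
by lra.
Qed.

End BoundaryUniqueness.

(** * The Nevanlinna class as a field up to null sets *)

Section NevanlinnaField.
Variable R : realType.
Implicit Types (f g h a b : R -> R[i]).

Local Notation D := (@circD R).
Local Notation circ := (@circ R).

Lemma hb_neq0 f : hb f -> ~ ae_T (fun x => f x = 0) -> ae_T (fun x => f x != 0).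
Proof.
move=> hf nf; have [[b1 b2] f0] := hf; have bf : cb f by split.
have ex : exists n, cI (fun x => f x * conjc (circ x) ^+ n) != 0.
  apply: contrapT => nex; apply: nf; apply: hb_coef0 => // n.
  by apply/eqP; apply/negP => /negP h; apply: nex; exists n.
(* [n] is the order of the zero at the origin. Dividing by [circ] to the power [n] stays in [hb]:
   the coefficients below [n] vanish by minimality, and the mean is normalised to 1. *)
case: (ex_minnP ex) => n; set c := cI _ => c0 minn.
have bn k : cb (fun x => f x * conjc (circ x) ^+ k).
  by apply: cbM => //; exact/cbX/cbJ/cb_circ.
have J k x : conjc (circ x) ^+ k * circ x ^+ k = 1.
  by rewrite -exprMn mulJ_circ expr1n.
pose g x := c^-1 * (f x * conjc (circ x) ^+ n).
have hg : hb g.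
  apply: hbZ; split => // k; have [nk|kn] := ltnP k n.
    rewrite (_ : (fun x => _) = fun x => f x * conjc (circ x) ^+ (n - k.+1)).
      apply/eqP/negP => /negP /minn; rewrite leqNgt ltn_subrL //=.
      by rewrite (leq_ltn_trans _ nk).
    apply/funext => x; rewrite -{1}(subnK nk) exprD -!mulrA; congr (_ * _).
    by rewrite J mulr1.
  rewrite (_ : (fun x => _) = fun x => f x * circ x ^+ (k - n).+1); first exact: f0.
  apply/funext => x; rewrite -subSn// -{1}(subnK (leqW kn)) exprD -mulrA; congr (_ * _).
  by rewrite mulrCA J mulr1.
have Ig : cI g = 1 by rewrite cIZ// mulVf.
pose E : set R := (D `&` [set x | Re (f x) = 0]) `&` (D `&` [set x | Im (f x) = 0]).
have mD := @measurable_circD R.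
have m0 (u : R -> R) : measurable_fun D u -> measurable (D `&` [set x | u x = 0]).
  by move=> mu; exact: mu mD _ (measurable_set1 0).
have mE : measurable E by apply: measurableI; apply: m0; [case: b1|case: b2].
have IE : RI (\1_E) = 0.
  apply: (hb_vanish_null hg) => // x Dx [[_ /= r0] [_ /= i0]].
  by rewrite /g (_ : f x = 0) ?mul0r ?mulr0//; exact: complex_ext.
have := RI_eq0_ae (bmeas_indic mE) _ IE; move=> /(_ _)[x _|]; first by rewrite indicE.
move=> N [mN N0 EN]; exists N; split => //; apply: subset_trans EN => x [Dx /= fx].
split => //=; rewrite indicE mem_set /= => [/eqP|]; first by rewrite oner_eq0.
by move/negP: fx; rewrite negbK => /eqP fx0; split; split => //=; rewrite fx0.
Qed.

Lemma inLinf_cb f : inLinf f -> exists2 g, cb g & ae_T (fun x => f x = g x).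
Proof.
move=> [[m1 m2] [M aM]]; have mD := @measurable_circD R.
(* Cutting [f] off outside [A] changes it only on a null set and makes it bounded everywhere. *)
pose A : set R := D `&` [set x | cnorm2 (f x) <= M].
have mA : measurable A.
  apply: measurable_fun_le => //.
  by apply: measurable_funD; exact: measurable_funX.
have iA := bmeas_indic mA.
have bA (u : R -> R) : measurable_fun D u ->
    (forall x, A x -> `|u x| ^+ 2 <= M) -> bmeas (fun x => \1_A x * u x).
  move=> mu uM; split; first by apply: measurable_funM => //; case: iA.
  exists (`|M| + 1) => x Dx; rewrite indicE.
  have [/set_mem Ax|_] := boolP (x \in A); last by rewrite mul0r normr0 addr_ge0.
  rewrite mul1r; have := uM x Ax; have := ler_norm M; have := normr_ge0 M.
  by have := normr_ge0 (u x); nra.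
exists (fun x => (\1_A x)%:C%C * f x).
  split.
    rewrite (_ : (fun x => _) = fun x => \1_A x * Re (f x)).
      apply: bA => // x [_ /=]; apply: le_trans.
      by rewrite real_normK ?num_real// lerDl sqr_ge0.
    by apply/funext => x; rewrite RecM /= mul0r subr0.
  rewrite (_ : (fun x => _) = fun x => \1_A x * Im (f x)).
    apply: bA => // x [_ /=]; apply: le_trans.
    by rewrite real_normK ?num_real// lerDr sqr_ge0.
  by apply/funext => x; rewrite ImcM /= mul0r addr0.
by apply: ae_T_imp aM => x Dx fM; rewrite indicE mem_set// mul1r.
Qed.

Lemma integral_ae (u v : R -> R) : measurable_fun D u -> measurable_fun D v ->
  ae_T (fun x => u x = v x) ->
  (\int[@lebR R]_(x in D) (u x)%:E = \int[@lebR R]_(x in D) (v x)%:E)%E.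
Proof.
move=> mu mv uv; apply: ae_eq_integral.
- exact: measurable_circD.
- exact/measurable_EFinP.
- exact/measurable_EFinP.
apply: negligibleS uv => x /= nx; apply: contrapT => h; apply: nx => Dx.
by congr EFin; apply: contrapT => nuv; apply: h.
Qed.

Lemma mul_circX_parts (z : R[i]) n x :
  Re (z * circ x ^+ n) = Re z * cos (n%:R * x) - Im z * sin (n%:R * x) /\
  Im (z * circ x ^+ n) = Re z * sin (n%:R * x) + Im z * cos (n%:R * x).
Proof. by rewrite circX !complexPartsE. Qed.

Lemma inHinf_hb f : inHinf f -> exists2 g, hb g & ae_T (fun x => f x = g x).
Proof.
move=> [Lf f0]; have [g bg fg] := inLinf_cb Lf; exists g => //; split => // n.
have [[m1 m2] _] := Lf; have [/= f1 f2] := f0 n.+1 isT.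
have bgc := cbM bg (@cb_circX R n.+1).
have mc : measurable_fun D (fun x => cos (n.+1%:R * x)).
  by have [[+ _] _] := @cb_circX R n.+1; under eq_fun do rewrite circX /=.
have ms : measurable_fun D (fun x => sin (n.+1%:R * x)).
  by have [_ [+ _]] := @cb_circX R n.+1; under eq_fun do rewrite circX /=.
have [[mr _] [mi _]] := bgc.
apply: complex_ext => /=; apply: EFin_inj; rewrite -integral_RI; try by case: bgc.
  apply: etrans f1; apply: integral_ae => //.
    by apply: measurable_funB; exact: measurable_funM.
  by apply: ae_T_imp fg => x Dx ->; rewrite (mul_circX_parts _ _ _).1.
apply: etrans f2; apply: integral_ae => //.
  by apply: measurable_funD; exact: measurable_funM.
by apply: ae_T_imp fg => x Dx ->; rewrite (mul_circX_parts _ _ _).2.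
Qed.

Lemma hb_inHinf f : hb f -> inHinf f.
Proof.
move=> [bf f0]; have [[m1 _] [m2 _]] := bf; split.
  split => //; have [_ [K fK]] := bmeas_cnorm2 bf; exists K.
  by apply: ae_T_all => x Dx; apply: le_trans (ler_norm _) (fK _ Dx).
case=> // n _; have [b1 b2] := cbM bf (@cb_circX R n.+1).
have /= [r0 i0] : Re (cI (fun x => f x * circ x ^+ n.+1)) = 0 /\
  Im (cI (fun x => f x * circ x ^+ n.+1)) = 0 by rewrite f0.
split.
  rewrite -[RHS]/(0%:E) -r0 -integral_RI//; apply: eq_integral => x _.
  by rewrite (mul_circX_parts _ _ _).1.
rewrite -[RHS]/(0%:E) -i0 -integral_RI//; apply: eq_integral => x _.
by rewrite (mul_circX_parts _ _ _).2.
Qed.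

Lemma ae_T_False : ~ ae_T (fun _ : R => False).
Proof.
move=> aF; have : lebR D = 0%E.
  apply: measure_negligible; first exact: measurable_circD.
  by apply: negligibleS aF => x Dx; split => // -[].
by rewrite lebR_circD => -[] /eqP; rewrite gt_eqF// pi2_gt0.
Qed.

(** A denominator that is not the zero function is nonzero almost everywhere by [hb_neq0], so
    fractions can be brought to a common denominator off a null set. *)
Lemma inNP f : inN f <-> exists g h,
  [/\ hb g, hb h, ae_T (fun x => h x != 0) & ae_T (fun x => f x = g x / h x)].
Proof.
split=> [[g [h [hg hh nh fE]]]|[g [h [hg hh nh fE]]]].
  have [g' hg' gE] := inHinf_hb hg; have [h' hh' hE] := inHinf_hb hh.
  exists g', h'; split => //.
    apply: hb_neq0 => // h0; apply: nh.
    by apply: ae_T_imp (ae_T_and h0 hE) => x _ [<-].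
  by apply: ae_T_imp (ae_T_and fE (ae_T_and gE hE)) => x _ [-> [-> ->]].
exists g, h; split => //; [exact: hb_inHinf..|move=> h0].
by apply: ae_T_False; apply: ae_T_imp (ae_T_and h0 nh) => x _ [-> /eqP].
Qed.

Lemma inN_cst (c : R[i]) : inN (fun=> c).
Proof.
apply/inNP; exists (fun=> c), (fun=> 1); split; [exact: hb_cst..| |].
  by apply: ae_T_all => x _; rewrite oner_neq0.
by apply: ae_T_all => x _; rewrite divr1.
Qed.

Lemma inND f g : inN f -> inN g -> inN (fun x => f x + g x).
Proof.
move=> /inNP[a [b [ha hb bn fE]]] /inNP[c [d [hc hd dn gE]]].
apply/inNP; exists (fun x => a x * d x + c x * b x), (fun x => b x * d x); split.
- by apply: hbD; exact: hbM.
- exact: hbM.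
- by apply: ae_T_imp (ae_T_and bn dn) => x _ [b0 d0]; rewrite mulf_neq0.
apply: ae_T_imp (ae_T_and (ae_T_and bn dn) (ae_T_and fE gE)) => x _ [[b0 d0] [-> ->]].
by rewrite addf_div.
Qed.

Lemma inNM f g : inN f -> inN g -> inN (fun x => f x * g x).
Proof.
move=> /inNP[a [b [ha hb bn fE]]] /inNP[c [d [hc hd dn gE]]].
apply/inNP; exists (fun x => a x * c x), (fun x => b x * d x); split.
- exact: hbM.
- exact: hbM.
- by apply: ae_T_imp (ae_T_and bn dn) => x _ [b0 d0]; rewrite mulf_neq0.
by apply: ae_T_imp (ae_T_and fE gE) => x _ [-> ->]; rewrite mulf_div.
Qed.

Lemma inN_sum (I : Type) (s : seq I) (P : pred I) (F : I -> R -> R[i]) :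
  (forall i, P i -> inN (F i)) -> inN (fun x => \sum_(i <- s | P i) F i x).
Proof.
move=> nF; elim: s => [|i s IH].
  by under eq_fun do rewrite big_nil; exact: inN_cst.
under eq_fun do rewrite big_cons; case: (boolP (P i)) => // Pi.
by apply: inND => //; exact: nF.
Qed.

Lemma inN_prod (I : Type) (s : seq I) (F : I -> R -> R[i]) :
  (forall i, inN (F i)) -> inN (fun x => \prod_(i <- s) F i x).
Proof.
move=> nF; elim: s => [|i s IH].
  by under eq_fun do rewrite big_nil; exact: inN_cst.
by under eq_fun do rewrite big_cons; exact: inNM.
Qed.

Lemma inN_mulmx (m n k : nat) (A : R -> 'M[R[i]]_(m, n)) (B : R -> 'M[R[i]]_(n, k)) :
  (forall i j, inN (fun x => A x i j)) -> (forall i j, inN (fun x => B x i j)) ->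
  forall i j, inN (fun x => (A x *m B x) i j).
Proof.
move=> nA nB i j; under eq_fun do rewrite mxE.
by apply: inN_sum => l _; exact: inNM.
Qed.

Lemma inN_det (n : nat) (A : R -> 'M[R[i]]_n) :
  (forall i j, inN (fun x => A x i j)) -> inN (fun x => \det (A x)).
Proof.
move=> nA; apply: inN_sum => s _; apply: inNM; first exact: inN_cst.
by apply: inN_prod.
Qed.

Lemma inN_adj (n : nat) (A : R -> 'M[R[i]]_n) :
  (forall i j, inN (fun x => A x i j)) -> forall i j, inN (fun x => (\adj (A x)) i j).
Proof.
move=> nA i j; under eq_fun do rewrite mxE.
apply: inNM; first exact: inN_cst.
by apply: inN_det => k l; under eq_fun do rewrite !mxE.
Qed.

(** The numerator of [f] is a nonzero bounded Hardy function, so [f] itself is nonzero almost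
    everywhere and can be cancelled. *)
Lemma inN_mul_eq0 f g : inN f -> ~ ae_T (fun x => f x = 0) ->
  ae_T (fun x => f x * g x = 0) -> ae_T (fun x => g x = 0).
Proof.
move=> /inNP[a [b [ha _ bn fE]]] nf fg.
have an : ae_T (fun x => a x != 0).
  apply: hb_neq0 => // a0; apply: nf.
  by apply: ae_T_imp (ae_T_and a0 fE) => x _ [-> ->]; rewrite mul0r.
apply: ae_T_imp (ae_T_and fg (ae_T_and fE (ae_T_and an bn))) => x _ [fg0 [fx [a0 b0]]].
move: fg0; rewrite fx => /eqP.
by rewrite !mulf_eq0 invr_eq0 (negbTE a0) (negbTE b0) => /eqP.
Qed.

End NevanlinnaField.

(** * Transfer of independence through multiplication by [A] *)

Section IndependenceModuloNevanlinna.
Variables (R : realType) (m r : nat).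
Variables (A : R -> 'M[R[i]]_m) (Phi : R -> 'M[R[i]]_(m, r)).

Lemma sum_col_mulmx (S : {set 'I_r}) (a : 'I_r -> R[i]) (x : R) :
  \sum_(i in S) a i *: col i (A x *m Phi x) = A x *m \sum_(i in S) a i *: col i (Phi x).
Proof.
by rewrite mulmx_sumr; apply: eq_bigr => i _; rewrite -scalemxAr !colE mulmxA.
Qed.

Lemma indep_modN_mulmx (S : {set 'I_r}) :
  (forall i j, inN (fun x => A x i j)) -> ~ ae_T (fun x => \det (A x) = 0) ->
  indep_modN (fun j x => col j (Phi x)) S <->
  indep_modN (fun j x => col j (A x *m Phi x)) S.
Proof.
move=> nA detA; have nd := inN_det nA; split=> iS a na nv i iSi.
- apply: (inN_mul_eq0 nd detA).
  apply: (iS (fun i x => \det (A x) * a i x)) => // [j Sj|k].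
    by apply: inNM => //; exact: na.
  (* Since adj A times [A] is det A times the identity, adj A turns the relation among the columns
     of A Phi into one among those of Phi. *)
  rewrite (_ : (fun x => _) = fun x =>
      (\adj (A x) *m \sum_(i in S) a i x *: col i (A x *m Phi x)) k 0).
    by apply: inN_mulmx; [exact: inN_adj|move=> l j; rewrite (ord1 j); exact: nv].
  apply/funext => x; rewrite sum_col_mulmx mulmxA mul_adj_mx mul_scalar_mx.
  by rewrite scaler_sumr; under [in RHS]eq_bigr do rewrite scalerA.
- apply: (iS a) => // k; under eq_fun do rewrite sum_col_mulmx.
  by apply: inN_mulmx => // l j; rewrite (ord1 j); exact: nv.
Qed.

End IndependenceModuloNevanlinna.

Theorem mainTheorem2 (R : realType) (m r : nat)
    (A : R -> 'M[R[i]]_m) (Phi : R -> 'M[R[i]]_(m, r)) :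
  (forall i j : 'I_m, inNinf (fun x => A x i j)) ->
  ~ ae_T (fun x => \det (A x) = 0) ->
  (forall (i : 'I_m) (j : 'I_r), inL2 (fun x => Phi x i j)) ->
  indN (fun (j : 'I_r) x => col j (Phi x)) =
  indN (fun (j : 'I_r) x => col j (A x *m Phi x)).
Proof.
(* Both indices are maxima over the same family of index sets. *)
move=> nA detA _; apply: eq_bigl => S; apply: asbool_equiv_eq.
by apply: indep_modN_mulmx => // i j; have [] := nA i j.
Qed.
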